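(* Let $d\ge 2$ be a nonsquare integer, let $(X_1,Y_1)$ be the fundamental solution of $x^2-dy^2=1$, put $\varepsilon=X_1+Y_1\sqrt d$, and let $K$ be an integer with $K>X_1$. Let $A$ (respectively $B$) be the sum of the $x$-coordinates (respectively $y$-coordinates) of all integer solutions $(x,y)$ of $x^2-dy^2=1$ with $0\le x,y<K$. Put $c=A^2-A-dB^2$. Then $c>B\sqrt d>0$, $$\varepsilon=\frac{c+B\sqrt d}{c-B\sqrt d},$$ and $$X_1=\frac{c^2+dB^2}{c^2-dB^2},\qquad Y_1=\frac{2Bc}{c^2-dB^2}.$$ Both of the last two quotients are integers.
   Context: The fundamental solution $(X_1,Y_1)$ of $x^2-dy^2=1$ is the solution in integers $X_1,Y_1>0$ with $X_1$ least. The nonnegative solutions are $(X_n,Y_n)$, $n\ge 0$, where $X_n+Y_n\sqrt d=\varepsilon^n$ and $(X_0,Y_0)=(1,0)$. Equivalently, $A=\sum_{n=0}^N X_n$ and $B=\sum_{n=0}^N Y_n$, where $N$ is determined by $X_N<K\le X_{N+1}$ (so $N\ge1$). *)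

(* Defs.v *)
From HB Require Import structures.
From mathcomp Require Import all_boot all_order all_algebra.
From mathcomp Require Import reals.

Set Implicit Arguments.
Unset Strict Implicit.
Unset Printing Implicit Defensive.

Import Order.TTheory GRing.Theory Num.Theory.
Local Open Scope ring_scope.

Definition pell (d x y : int) : bool := x ^+ 2 - d * y ^+ 2 == 1.

Definition nonsquare (d : int) : Prop := forall m : int, m ^+ 2 <> d.

Definition fundamental_solution (d X1 Y1 : int) : Prop :=
  [/\ 0 < X1, 0 < Y1, pell d X1 Y1 &
      forall x y : int, 0 < x -> 0 < y -> pell d x y -> X1 <= x].

(* For 0 <= K, the integer points of the box 0 <= x, y < K are the pairs of
   ordinals below `|K|%N = K; the sums are only meaningful for such K. *)
Definition sum_x_coords (d K : int) : int :=
  \sum_(p : 'I_`|K|%N * 'I_`|K|%N | pell d (p.1)%:Z (p.2)%:Z) (p.1)%:Z.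

Definition sum_y_coords (d K : int) : int :=
  \sum_(p : 'I_`|K|%N * 'I_`|K|%N | pell d (p.1)%:Z (p.2)%:Z) (p.2)%:Z.

(* Main.v *)
Require Import Defs.
From HB Require Import structures.
From mathcomp Require Import all_boot all_order all_algebra.
From mathcomp Require Import reals.
From mathcomp Require Import zify ring.

Set Implicit Arguments.
Unset Strict Implicit.
Unset Printing Implicit Defensive.

Import Order.TTheory GRing.Theory Num.Theory.
Local Open Scope ring_scope.

(** Write [s] for the square root of [d], [eps = X1 + Y1 s] and
    [del = X1 - Y1 s], so that [eps * del = 1].  The nonnegative solutions of
    the Pell equation are exactly the coordinates of the powers of [eps]
    ([pell_orbit_complete], by descent), and their abscissas increase, so the
    solutions in the box are those of [eps ^ n] for [n < M], for some
    [M >= 2] ([box_orbit]).  Consequently [A + B s] and [A - B s] are the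
    geometric sums [S] and [T] of the powers of [eps] and [del] below [M].

    The number [c] is designed so that both conjugates factor: since
    [A^2 - d B^2 = S T] and [2 A = S + T], one has
    [c + B s = T (S - 1)] and [c - B s = S (T - 1)].
    Reversing the order of summation gives [S = eps^(M-1) T], and likewise
    for the two shorter sums [S - 1 = eps (1 + ... + eps^(M-2))] and
    [T - 1 = del (1 + ... + del^(M-2))]; in the quotient
    [T (S - 1) / (S (T - 1))] the powers cancel down to a single [eps]
    ([geometric_ratio]).  Positivity of [c - B s] is [T > 1], where
    [M >= 2] is used.  The formulas for [X1] and [Y1] are then
    the half-sum and half-difference of [eps] and [del = 1 / eps]. *)

(** * The orbit of the trivial solution under the fundamental one *)

(** Multiplication by [X + Y s], in coordinates. *)
Definition pell_step (d X Y : int) (p : int * int) : int * int :=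
  (X * p.1 + d * Y * p.2, Y * p.1 + X * p.2).

Definition pell_orbit (d X Y : int) (n : nat) : int * int :=
  iter n (pell_step d X Y) (1, 0).

Lemma pell_orbitS d X Y n :
  pell_orbit d X Y n.+1 = pell_step d X Y (pell_orbit d X Y n).
Proof. by []. Qed.

(** Taking [t] to be either square root of [d] yields the powers of [eps] and
    those of its conjugate. *)
Lemma pell_orbit_expr (R : comPzRingType) (t : R) (d X Y : int) n :
  t ^+ 2 = d%:~R ->
  (pell_orbit d X Y n).1%:~R + (pell_orbit d X Y n).2%:~R * t
  = (X%:~R + Y%:~R * t) ^+ n.
Proof.
move=> t2; elim: n => [|n IHn]; first by rewrite expr0 /= mul0r addr0.
rewrite exprS -IHn pell_orbitS /pell_step /= !rmorphD !rmorphM /= -t2.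
ring.
Qed.

Lemma pell_orbit_sum_expr (R : comPzRingType) (t : R) (d X Y : int) M :
  t ^+ 2 = d%:~R ->
  (\sum_(n < M) (pell_orbit d X Y n).1)%:~R
    + (\sum_(n < M) (pell_orbit d X Y n).2)%:~R * t
  = \sum_(n < M) (X%:~R + Y%:~R * t) ^+ n.
Proof.
move=> t2; rewrite !rmorph_sum mulr_suml -big_split /=.
by apply: eq_bigr => n _; exact: pell_orbit_expr.
Qed.

Lemma pell_snd_lt_fst (d x y : int) :
  1 <= d -> 0 <= x -> 0 <= y -> pell d x y -> y < x.
Proof. by move=> d1 x0 y0 /eqP pxy; nia. Qed.

Section Fundamental.

Variables d X Y : int.
Hypotheses (d_ge1 : 1 <= d) (fund : fundamental_solution d X Y).

Lemma fundamental_gt1 : 1 < X.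
Proof. by case: fund => X0 Y0 /eqP pXY _; nia. Qed.

Let orb := pell_orbit d X Y.

Lemma pell_orbitP n :
  [/\ 0 < (orb n).1, 0 <= (orb n).2 & pell d (orb n).1 (orb n).2].
Proof.
have [X0 Y0 /eqP pXY _] := fund; rewrite /orb.
elim: n => [|n]; first by rewrite /pell /= expr0n mulr0 subr0 expr1n eqxx.
rewrite pell_orbitS; case: (pell_orbit d X Y n) => x y /= [x0 y0 /eqP pxy].
split; [by nia | by nia | apply/eqP].
(* the norm is multiplicative *)
have -> : (X * x + d * Y * y) ^+ 2 - d * (Y * x + X * y) ^+ 2
  = (X ^+ 2 - d * Y ^+ 2) * (x ^+ 2 - d * y ^+ 2) by ring.
by rewrite pXY pxy.
Qed.

Lemma pell_orbit_fst_incr n : (orb n).1 < (orb n.+1).1.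
Proof.
have [x0 y0 _] := pell_orbitP n; have X1 := fundamental_gt1.
have [_ Y0 _ _] := fund.
by rewrite /orb pell_orbitS /=; rewrite -/(orb n); nia.
Qed.

Lemma pell_orbit_fst_mono m n : ((orb m).1 < (orb n).1) = (m < n)%N.
Proof.
have incr : {homo (fun n => (orb n).1) : m n / (m < n)%N >-> m < n}.
  by apply: homo_ltn => [y x z|k]; [exact: lt_trans | exact: pell_orbit_fst_incr].
case: (ltngtP m n) => [/incr //|/incr /ltW|->]; last by rewrite ltxx.
by rewrite leNgt => /negbTE.
Qed.

Lemma pell_orbit_fst_gt n : n%:Z < (orb n).1.
Proof.
elim: n => [|n IHn]; first by [].
by have := pell_orbit_fst_incr n; lia.
Qed.

(** Descent: dividing a nontrivial solution by the fundamental one lowers the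
    abscissa, and the ordinate stays nonnegative because [X], hence also [Y],
    is minimal among the nontrivial solutions. *)
Lemma pell_descent (x y : int) :
  0 < x -> 0 < y -> pell d x y ->
  exists p : int * int,
    [/\ 0 < p.1 < x, 0 <= p.2, pell d p.1 p.2 & pell_step d X Y p = (x, y)].
Proof.
move=> x0 y0 pxy; have [X0 Y0 /eqP pXY minX] := fund.
have Xx := minX _ _ x0 y0 pxy; have X1 := fundamental_gt1.
move/eqP: pxy => pxy.
have X2 : X ^+ 2 = 1 + d * Y ^+ 2 by rewrite -pXY subrK.
have x2 : x ^+ 2 = 1 + d * y ^+ 2 by rewrite -pxy subrK.
pose x' := X * x - d * Y * y; pose y' := X * y - Y * x.
have back1 : X * x' + d * Y * y' = x.
  by rewrite -[RHS]mul1r -pXY /x' /y'; ring.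
have back2 : Y * x' + X * y' = y.
  by rewrite -[RHS]mul1r -pXY /x' /y'; ring.
have pxy' : x' ^+ 2 - d * y' ^+ 2 = 1.
  have -> : x' ^+ 2 - d * y' ^+ 2
    = (X ^+ 2 - d * Y ^+ 2) * (x ^+ 2 - d * y ^+ 2) by rewrite /x' /y'; ring.
  by rewrite pXY pxy.
have x'0 : 0 < x'.
  rewrite subr_gt0 -(@ltr_pXn2r _ 2) // ?nnegrE ?mulr_ge0 //; try lia.
  have -> : (X * x) ^+ 2 = (1 + d * Y ^+ 2) * (1 + d * y ^+ 2).
    by rewrite exprMn X2 x2.
  have -> : (d * Y * y) ^+ 2 = (d * Y ^+ 2) * (d * y ^+ 2) by ring.
  have a0 : 0 <= d * Y ^+ 2 by rewrite mulr_ge0 ?sqr_ge0 //; lia.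
  have b0 : 0 <= d * y ^+ 2 by rewrite mulr_ge0 ?sqr_ge0 //; lia.
  by rewrite mulrDl mul1r mulrDr mulr1; lia.
have Yy : Y <= y.
  rewrite -(@ler_pXn2r _ 2) // ?nnegrE; try lia.
  rewrite -(@ler_pM2l _ d); last lia.
  have : X ^+ 2 <= x ^+ 2 by rewrite ler_pXn2r // ?nnegrE; lia.
  by lia.
have y'0 : 0 <= y'.
  rewrite subr_ge0 -(@ler_pXn2r _ 2) // ?nnegrE ?mulr_ge0 //; try lia.
  rewrite !exprMn X2 x2.
  have : Y ^+ 2 <= y ^+ 2 by rewrite ler_pXn2r // ?nnegrE; lia.
  by lia.
exists (x', y'); split=> //=.
- by rewrite x'0 /=; move: back1 X1 x'0 y'0 Y0 d_ge1; clear; nia.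
- exact/eqP.
- by rewrite /pell_step /= back1 back2.
Qed.

Lemma pell_orbit_complete (x y : int) :
  0 <= x -> 0 <= y -> pell d x y -> exists n, orb n = (x, y).
Proof.
move=> x0 y0 pxy; have [b ltxb] : exists b : nat, x < b%:Z.
  by exists `|x|.+1%N; lia.
elim: b x y x0 y0 pxy ltxb => [|b IHb] x y x0 y0 pxy ltxb; first by lia.
have x_gt0 : 0 < x by move/eqP: pxy; nia.
have [y_eq0|y_gt0] : y = 0 \/ 0 < y by lia.
  by exists 0%N; move/eqP: pxy; rewrite y_eq0 /orb /= => pxy; congr pair; nia.
have [[x' y'] /= [/andP[x'0 x'x] y'0 pxy' step]] := pell_descent x_gt0 y_gt0 pxy.
have [|n En] := IHb x' y' (ltW x'0) y'0 pxy'; first by lia.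
by exists n.+1; rewrite /orb pell_orbitS -/(orb n) En.
Qed.

(** * The solutions in the box *)

(** The abscissa alone decides membership in the box, since the ordinate of a
    solution is smaller; hence the points of the box form an initial segment
    of the orbit. *)
Lemma box_orbit (K : int) : X < K ->
  exists2 M, (1 < M)%N &
    sum_x_coords d K = \sum_(n < M) (orb n).1 /\
    sum_y_coords d K = \sum_(n < M) (orb n).2.
Proof.
move=> ltXK; have X1 := fundamental_gt1.
have [|M leKM minM] := @ex_minnP (fun n => K <= (orb n).1).
  by exists `|K|%N; have := pell_orbit_fst_gt `|K|%N; lia.
have inbox n : ((orb n).1 < K) = (n < M)%N.
  apply/idP/idP => [ltnK|]; last first.
    by rewrite ltnNge ltNge; apply: contra; exact: minM.
  by rewrite -pell_orbit_fst_mono (lt_le_trans ltnK leKM).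
have M1 : (1 < M)%N.
  by rewrite -inbox /orb /= mulr1 mulr0 addr0.
exists M => //.
have [k Kk] : exists k : nat, `|K|%N = k.+1 by exists `|K|.-1%N; lia.
pose h (n : 'I_M) : 'I_k.+1 * 'I_k.+1 :=
  (inord `|(orb n).1|%N, inord `|(orb n).2|%N).
have hE (n : 'I_M) : (h n).1%:Z = (orb n).1 /\ (h n).2%:Z = (orb n).2.
  have [x0 y0 pxy] := pell_orbitP n.
  have := pell_snd_lt_fst d_ge1 (ltW x0) y0 pxy.
  have := inbox n; rewrite ltn_ord => ltxK ltyx.
  by rewrite /= !inordK; [split; lia | lia | lia].
have h_inj : injective h.
  move=> m n Emn; have [Em _] := hE m; have [En _] := hE n.
  have Exy : (orb m).1 = (orb n).1 by rewrite -Em Emn.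
  apply: val_inj => /=.
  by case: (ltngtP m n) => //; rewrite -pell_orbit_fst_mono Exy ltxx.
have box_image (F : 'I_k.+1 * 'I_k.+1 -> int) :
  \sum_(p : 'I_k.+1 * 'I_k.+1 | pell d p.1%:Z p.2%:Z) F p
  = \sum_(n < M) F (h n).
  rewrite -(big_imset F (h := h) (A := 'I_M)) /=; last by move=> ? ? _ _ /h_inj.
  apply: eq_bigl => p; apply/idP/imsetP => [pp|[n _ ->]]; last first.
    by have [-> ->] := hE n; have [_ _] := pell_orbitP n.
  have [n En] := pell_orbit_complete (le0z_nat p.1) (le0z_nat p.2) pp.
  have ltnM : (n < M)%N by rewrite -inbox En /=; have := ltn_ord p.1; lia.
  exists (Ordinal ltnM) => //.
  case: (h _) (hE (Ordinal ltnM)) => u v; rewrite /= En /= => -[[E1] [E2]].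
  by rewrite [LHS]surjective_pairing; congr pair; exact: val_inj.
rewrite /sum_x_coords /sum_y_coords Kk !box_image.
by split; apply: eq_bigr => n _; have [] := hE n.
Qed.

End Fundamental.

(** * Geometric sums of inverse ratios *)

(** After multiplication by [(eps - 1) (del - 1)] both sides become
    [1 + eps - eps ^ M - eps * del ^ M]. *)
Lemma geometric_ratio (F : fieldType) (eps del : F) M :
  eps * del = 1 -> eps != 1 ->
  let S := \sum_(n < M) eps ^+ n in
  let T := \sum_(n < M) del ^+ n in
  T * (S - 1) = eps * (S * (T - 1)).
Proof.
move=> ed e1 S T.
have d1 : del != 1 by apply: contraNneq e1 => d1; rewrite -ed d1 mulr1.
have ES : (eps - 1) * S = eps ^+ M - 1 by rewrite subrX1.
have ET : (del - 1) * T = del ^+ M - 1 by rewrite subrX1.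
have ED : eps ^+ M * del ^+ M = 1 by rewrite -exprMn ed expr1n.
have nz : (eps - 1) * (del - 1) != 0 by rewrite mulf_neq0 ?subr_eq0.
apply: (mulfI nz).
have -> : (eps - 1) * (del - 1) * (T * (S - 1))
  = ((del - 1) * T) * ((eps - 1) * S - (eps - 1)) by ring.
have -> : (eps - 1) * (del - 1) * (eps * (S * (T - 1)))
  = ((eps - 1) * S) * (eps * ((del - 1) * T) - (eps * del - eps)) by ring.
rewrite ES ET ed.
have -> : (del ^+ M - 1) * (eps ^+ M - 1 - (eps - 1))
  = eps ^+ M * del ^+ M - eps * del ^+ M - eps ^+ M + eps by ring.
have -> : (eps ^+ M - 1) * (eps * (del ^+ M - 1) - (1 - eps))
  = eps * (eps ^+ M * del ^+ M) - eps * del ^+ M - eps ^+ M + 1 by ring.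
by rewrite ED; ring.
Qed.

Lemma geometric_sum_gt1 (F : numDomainType) (q : F) M :
  0 < q -> (1 < M)%N -> 1 < \sum_(n < M) q ^+ n.
Proof.
case: M => [//|[//|M]] q0 _; rewrite !big_ord_recl expr0 expr1 ltrDl.
by rewrite ltr_pwDl // sumr_ge0 // => n _; rewrite exprn_ge0 // ltW.
Qed.

(** The conjugate of [(u + v s) / (u - v s)] is its inverse; the coordinates
    are read off as half-sum and half-difference of the two. *)
Lemma conjugate_quotient_coords (F : numFieldType) (x y u v s : F) :
  s != 0 -> (x + y * s) * (x - y * s) = 1 ->
  u - v * s != 0 -> u + v * s != 0 ->
  x + y * s = (u + v * s) / (u - v * s) ->
  x = (u ^+ 2 + s ^+ 2 * v ^+ 2) / (u ^+ 2 - s ^+ 2 * v ^+ 2) /\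
  y = 2 * v * u / (u ^+ 2 - s ^+ 2 * v ^+ 2).
Proof.
move=> s0 xy1 um up e.
have e' : x - y * s = (u - v * s) / (u + v * s).
  have e0 : x + y * s != 0 by rewrite e mulf_neq0 ?invr_neq0.
  by apply: (mulfI e0); rewrite xy1 e; field; apply/andP.
have -> : u ^+ 2 - s ^+ 2 * v ^+ 2 = (u + v * s) * (u - v * s) by ring.
have two0 : (2 : F) != 0 by rewrite pnatr_eq0.
split.
- apply: (mulfI two0).
  have -> : 2 * x = (x + y * s) + (x - y * s) by ring.
  by rewrite e e'; field; apply/andP.
- apply: (mulfI (mulf_neq0 two0 s0)).
  have -> : 2 * s * y = (x + y * s) - (x - y * s) by ring.
  by rewrite e e'; field; apply/andP.
Qed.

(** * The fundamental solution recovered from the box sums *)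

Theorem theorem1 (R : realType) (d X1 Y1 K A B c : int) (sqrtd eps : R)
    (d_ge2 : 2 <= d) (d_nonsquare : nonsquare d)
    (fund : fundamental_solution d X1 Y1)
    (sqrtdE : sqrtd = Num.sqrt d%:~R)
    (epsE : eps = X1%:~R + Y1%:~R * sqrtd)
    (K_gt : X1 < K)
    (AE : A = sum_x_coords d K)
    (BE : B = sum_y_coords d K)
    (cE : c = A ^+ 2 - A - d * B ^+ 2) :
  let qX : R := (c ^+ 2 + d * B ^+ 2)%:~R / (c ^+ 2 - d * B ^+ 2)%:~R in
  let qY : R := (2 * B * c)%:~R / (c ^+ 2 - d * B ^+ 2)%:~R in
  [/\ B%:~R * sqrtd < c%:~R /\ 0 < B%:~R * sqrtd,
      eps = (c%:~R + B%:~R * sqrtd) / (c%:~R - B%:~R * sqrtd),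
      X1%:~R = qX /\ Y1%:~R = qY &
      qX \is a Num.int /\ qY \is a Num.int].
Proof.
move=> qX qY; have d1 : 1 <= d by lia.
have [M M1 [sumx sumy]] := box_orbit d1 fund K_gt.
rewrite -AE in sumx; rewrite -BE in sumy.
have dR0 : 0 < d%:~R :> R by rewrite ltr0z; lia.
have s0 : 0 < sqrtd by rewrite sqrtdE sqrtr_gt0.
have s2 : sqrtd ^+ 2 = d%:~R by rewrite sqrtdE sqr_sqrtr // ltW.
have [X0 Y0 /eqP pXY _] := fund.
have X0R : 0 < X1%:~R :> R by rewrite ltr0z.
have Y0R : 0 < Y1%:~R :> R by rewrite ltr0z.
have B0 : 0 < B.
  rewrite sumy; case: M M1 {sumx sumy} => [//|[//|M]] _.
  rewrite !big_ord_recl /= mulr1 mulr0 addr0 add0r ltr_pwDl //.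
  by rewrite sumr_ge0 // => n _; have [] := pell_orbitP d1 fund n.+2.
have Bs0 : 0 < B%:~R * sqrtd by rewrite mulr_gt0 // ltr0z.
pose del : R := X1%:~R - Y1%:~R * sqrtd.
have ed : eps * del = 1.
  have -> : 1 = (X1 ^+ 2 - d * Y1 ^+ 2)%:~R :> R by rewrite pXY.
  by rewrite !(rmorphB, rmorphXn, rmorphM) /= -s2 epsE /del; ring.
have eps_gt1 : 1 < eps.
  rewrite epsE ltr_wpDr ?mulr_ge0 ?ltW //.
  by rewrite -[1]/(1%:~R) ltr_int; exact: fundamental_gt1 d1 fund.
have eps0 : 0 < eps by apply: lt_trans eps_gt1.
have del0 : 0 < del by rewrite -(pmulr_rgt0 _ eps0) ed.
pose S := \sum_(n < M) eps ^+ n; pose T := \sum_(n < M) del ^+ n.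
have SE : A%:~R + B%:~R * sqrtd = S.
  by rewrite sumx sumy pell_orbit_sum_expr // -epsE.
have TE : A%:~R - B%:~R * sqrtd = T.
  by rewrite sumx sumy -mulrN pell_orbit_sum_expr ?sqrrN // mulrN.
have S1 : 1 < S by exact: geometric_sum_gt1.
have T1 : 1 < T by exact: geometric_sum_gt1.
have cRE : c%:~R = A%:~R ^+ 2 - A%:~R - sqrtd ^+ 2 * B%:~R ^+ 2 :> R.
  by rewrite s2 cE !(rmorphB, rmorphXn, rmorphM).
have cplus : c%:~R + B%:~R * sqrtd = T * (S - 1) by rewrite cRE -SE -TE; ring.
have cminus : c%:~R - B%:~R * sqrtd = S * (T - 1) by rewrite cRE -SE -TE; ring.
have cminus0 : 0 < c%:~R - B%:~R * sqrtd.
  by rewrite cminus mulr_gt0 ?subr_gt0 // (lt_trans ltr01).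
have cplus0 : 0 < c%:~R + B%:~R * sqrtd.
  by rewrite cplus mulr_gt0 ?subr_gt0 // (lt_trans ltr01).
have eps_quot : eps = (c%:~R + B%:~R * sqrtd) / (c%:~R - B%:~R * sqrtd).
  apply: (canRL (mulfK (lt0r_neq0 cminus0))).
  by rewrite cplus cminus -geometric_ratio // gt_eqF.
have [XE YE] : X1%:~R = qX /\ Y1%:~R = qY.
  rewrite /qX /qY !(rmorph_nat, rmorphB, rmorphD, rmorphXn, rmorphM) /= -s2.
  apply: conjugate_quotient_coords; rewrite ?lt0r_neq0 //.
  - by rewrite -epsE.
  - by rewrite -epsE.
split=> //; first by rewrite -subr_gt0.
by rewrite -XE -YE !intr_int.
Qed.
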